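(* Let $K$ be a field of characteristic $p>0$, let $n\ge1$, let $R=\bigoplus_{\ell=0}^{n(p-1)}R^\ell=K[y_1,\dots,y_n]/(y_1^p,\dots,y_n^p)$ and $\mathrm D=\bigoplus_{\ell=0}^{n(p-1)}\mathrm D_\ell=K[\partial_{y_1},\dots,\partial_{y_n}]/(\partial_{y_1}^p,\dots,\partial_{y_n}^p)$, acting on $R$ by partial derivations. Let $V\subset R^\ell$ be a linear subspace and let $\mathbb L(\mathrm D_{2\ell-n(p-1)}\cdot V)$ be the linear subspace generated by $\mathrm D_{2\ell-n(p-1)}\cdot V\subset R^{n(p-1)-\ell}$. Then $$\dim(V)\le\dim\,\mathbb L(\mathrm D_{2\ell-n(p-1)}\cdot V)\qquad\text{when }\ \frac{n(p-1)}2\le\ell\le n(p-1).$$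
   Context: $R^\ell$ is the $K$-linear span of $\{y_1^{k_1}\cdots y_n^{k_n}\mid k_1+\cdots+k_n=\ell,\ 0\le k_i\le p-1\}$. The polynomial ring $K[\partial_{y_1},\dots,\partial_{y_n}]$ acts on $R$ through partial derivatives; since each $\partial_{y_i}^p$ acts trivially, this makes $R$ a $\mathrm D$-module. $\mathrm D_\ell$ is the space of homogeneous elements of degree $\ell$ in the classes of the $\partial_{y_i}$. $\mathrm D_j\cdot V=\{d\cdot v\mid d\in\mathrm D_j,\ v\in V\}$. *)

(* Defs.v *)
From HB Require Import structures.
From mathcomp Require Import all_boot all_order all_algebra.
From mathcomp Require Import generic_quotient ring_quotient.
From mathcomp Require Import boolp classical_sets.
From mathcomp Require Import ssrcomplements mpoly.

Set Implicit Arguments.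
Unset Strict Implicit.
Unset Printing Implicit Defensive.

Import GRing.Theory.
Local Open Scope ring_scope.
Local Open Scope quotient_scope.

Section LinearHull.
Context (K : fieldType) (E : vectType K).
Implicit Types (S : set E) (W : {vspace E}).

Lemma linear_hull_exists S : exists W, forall v,
  v \in W <-> exists2 s : seq E, (forall u, u \in s -> S u) & v \in <<s>>%VS.
Proof.
pose P d := `[< exists2 s : seq E, (forall u, u \in s -> S u) & \dim <<s>> = d >].
have exP : exists d, P d.
  by exists (\dim (<<[::]>> : {vspace E})); apply/asboolP; exists [::].
have leP d : P d -> (d <= \dim {:E})%N.
  by case/asboolP => s _ <-; apply/dimvS/subvf.
case: (ex_maxnP exP leP) => d /asboolP[s sS dims] maxd.
exists <<s>>%VS => v; split=> [vs | [t tS vt]]; first by exists s.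
have stS : forall u, u \in s ++ t -> S u.
  by move=> u; rewrite mem_cat => /orP[/sS | /tS].
have sub : (<<s>> <= <<s ++ t>>)%VS by rewrite span_cat addvSl.
have le_dim : (\dim <<s ++ t>> <= \dim <<s>>)%N.
  by rewrite dims; apply/maxd/asboolP; exists (s ++ t).
have /eqP-> : (<<s>> == <<s ++ t>>)%VS by rewrite eqEdim sub.
by rewrite span_cat; apply: subvP vt; apply: addvSr.
Qed.

Definition linear_hull S : {vspace E} := projT1 (cid (linear_hull_exists S)).

Lemma linear_hullP S v :
  v \in linear_hull S <->
  exists2 s : seq E, (forall u, u \in s -> S u) & v \in <<s>>%VS.
Proof. by rewrite /linear_hull; case: cid. Qed.

Lemma linear_hull_min S W :
  (forall v, S v -> v \in W) -> (linear_hull S <= W)%VS.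
Proof.
move=> SW; apply/subvP => v /linear_hullP[s sS]; apply: subvP.
by apply/span_subvP => u /sS /SW.
Qed.

Lemma mem_linear_hull S v : S v -> v \in linear_hull S.
Proof.
move=> Sv; apply/linear_hullP; exists [:: v]; last exact/memv_span/mem_head.
by move=> u; rewrite inE => /eqP->.
Qed.

End LinearHull.

(* The ideal (y_1^p, ..., y_n^p). The characteristic assumption is a parameter
   because the ideal is proper only for p > 0. *)
Definition pow_ideal (K : fieldType) (n p : nat) of p \in [pchar K] :
    {pred {mpoly K[n]}} :=
  fun f => `[< exists g : 'I_n -> {mpoly K[n]}, f = \sum_i g i * 'X_i ^+ p >].

Section PowIdeal.
Context (K : fieldType) (n p : nat) (charKp : p \in [pchar K]).
Local Notation I := (pow_ideal (n := n) charKp).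

Let p_gt0 : (0 < p)%N. Proof. exact/prime_gt0/(pcharf_prime charKp). Qed.

Definition truncated (k : 'X_{1..n}) := [forall i, (k i < p)%N].

Lemma mem_pow_ideal f : f \in I <-> forall k, truncated k -> f@_k = 0.
Proof.
split=> [/asboolP[g ->] k /forallP kp | f0].
  rewrite raddf_sum big1 //= => i _; rewrite mpolyXn mcoeffMr.
  rewrite big1 // => -[k1 k2] /= /eqP kE; rewrite mcoeffX.
  case: eqP => [k2E|_]; last by rewrite mulr0.
  move/mnmP/(_ i): kE; rewrite mnmDE -k2E mulmnE mnm1E eqxx mul1n => kE.
  by have := kp i; rewrite kE ltnNge leq_addr.
apply/asboolP.
pose c (k : 'X_{1..n}) := [pick i | (p <= k i)%N].
exists (fun i => \sum_(k <- msupp f | c k == Some i)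
                    f@_k *: 'X_[k - U_(i) *+ p]).
rewrite [LHS]mpolyE; under [RHS]eq_bigr do rewrite mulr_suml.
rewrite (exchange_big_dep xpredT) //= big_seq [RHS]big_seq.
apply: eq_bigr => k kf.
have [i ci] : exists i, c k = Some i.
  rewrite /c; case: pickP => [i _|no]; first by exists i.
  have : f@_k = 0 by apply: f0; apply/forallP => i; rewrite ltnNge no.
  by move/eqP; rewrite mcoeff_eq0 kf.
rewrite (big_pred1 i) => [|j]; last by rewrite ci (inj_eq Some_inj) eq_sym.
rewrite mpolyXn -scalerAl -mpolyXD submK //; apply/mnm_lepP => j.
rewrite mulmnE mnm1E; case: eqP => [<-|]; last by rewrite mul0n.
by move: ci; rewrite mul1n /c; case: pickP => // i' ? [<-].
Qed.

Lemma pow_ideal_idealr : idealr_closed I.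
Proof.
split.
- by apply/mem_pow_ideal => k _; rewrite mcoeff0.
- apply/negP => /mem_pow_ideal/(_ 0%MM) h.
  have /eqP : (1 : {mpoly K[n]})@_0 = 0.
    by apply: h; apply/forallP => i; rewrite mnm0E.
  by rewrite mcoeff1 eqxx oner_eq0.
- move=> a u v /asboolP[g ->] /asboolP[h ->]; apply/asboolP.
  exists (fun i => a * g i + h i); rewrite mulr_sumr -big_split /=.
  by apply: eq_bigr => i _; rewrite mulrDl mulrA.
Qed.

HB.instance Definition _ := isIdealr.Build {mpoly K[n]} I pow_ideal_idealr.

End PowIdeal.

(* Both R = K[y_1, ..., y_n] / (y_i^p) and D = K[d_1, ..., d_n] / (d_i^p):
   the two algebras differ only in the names of the variables. *)
Definition truncpoly (K : fieldType) (n p : nat) (charKp : p \in [pchar K]) :=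
  {ideal_quot (pow_ideal (n := n) charKp)}.
Arguments truncpoly [K] n [p] charKp.

Section TruncPoly.
Context (K : fieldType) (n p : nat) (charKp : p \in [pchar K]).
Local Notation P := {mpoly K[n]}.
Local Notation R := (truncpoly n charKp).
Local Notation I := (pow_ideal (n := n) charKp).

HB.instance Definition _ := GRing.ComNzRing.on R.

Let p_gt0 : (0 < p)%N. Proof. exact/prime_gt0/(pcharf_prime charKp). Qed.

(* The class of a polynomial modulo (y_1^p, ..., y_n^p). *)
Definition tproj (f : P) : R := \pi_({ideal_quot I}) f.

Lemma tproj_eq f g : tproj f = tproj g <-> f - g \in I.
Proof. by rewrite Quotient.idealrBE; split=> /eqP. Qed.

Lemma tproj_eqP f g :
  tproj f = tproj g <-> forall k, truncated p k -> f@_k = g@_k.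
Proof.
rewrite tproj_eq mem_pow_ideal; split=> fg k /fg; rewrite mcoeffB.
  by move/eqP; rewrite subr_eq0 => /eqP.
by move=> ->; rewrite subrr.
Qed.

Lemma tproj_repr (x : R) : tproj (repr x) = x.
Proof. exact: reprK. Qed.

Lemma tproj_zmod_morphism : zmod_morphism tproj.
Proof. by move=> f g; rewrite /tproj rmorphB. Qed.

Lemma tproj_monoid_morphism : monoid_morphism tproj.
Proof. by split=> [|f g]; rewrite /tproj ?rmorph1 ?rmorphM. Qed.

HB.instance Definition _ :=
  GRing.isZmodMorphism.Build P R tproj tproj_zmod_morphism.
HB.instance Definition _ :=
  GRing.isMonoidMorphism.Build P R tproj tproj_monoid_morphism.

Definition tscale (a : K) (x : R) : R := tproj (a *: repr x).

Lemma tscaleE a f : tscale a (tproj f) = tproj (a *: f).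
Proof.
apply/tproj_eqP => k kp; rewrite !mcoeffZ; congr (_ * _).
by have /tproj_eqP := tproj_repr (tproj f); apply.
Qed.

Fact tscaleA a b x : tscale a (tscale b x) = tscale (a * b) x.
Proof. by rewrite -(tproj_repr x) !tscaleE scalerA. Qed.

Fact tscale1 : left_id 1 tscale.
Proof. by move=> x; rewrite -(tproj_repr x) tscaleE scale1r. Qed.

Fact tscaleDr : right_distributive tscale +%R.
Proof.
move=> a x y; rewrite -(tproj_repr x) -(tproj_repr y) -rmorphD !tscaleE.
by rewrite scalerDr rmorphD.
Qed.

Fact tscaleDl x : {morph tscale^~ x : a b / a + b}.
Proof. by move=> a b; rewrite -(tproj_repr x) !tscaleE scalerDl rmorphD. Qed.

HB.instance Definition _ := GRing.Zmodule_isLmodule.Build K R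
  tscaleA tscale1 tscaleDr tscaleDl.

Lemma tproj_scalable : scalable tproj.
Proof. by move=> a f; rewrite -tscaleE. Qed.

HB.instance Definition _ :=
  GRing.isScalable.Build K P R *:%R tproj tproj_scalable.

Definition tmonom (k : {ffun 'I_n -> 'I_p}) : 'X_{1..n} := [multinom k i | i < n].

Lemma tmonom_inj : injective tmonom.
Proof.
by move=> k l /mnmP kl; apply/ffunP => i; apply/val_inj; have := kl i;
   rewrite !mnmE.
Qed.

Lemma truncatedP (k : 'X_{1..n}) : reflect (exists l, k = tmonom l) (truncated p k).
Proof.
apply: (iffP forallP) => [kp|[l ->] i]; last by rewrite mnmE.
exists [ffun i => Ordinal (kp i)]; apply/mnmP => i.
by rewrite mnmE ffunE.
Qed.

Definition tcoord (x : R) : 'rV[K]_#|{ffun 'I_n -> 'I_p}| :=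
  \row_j (repr x)@_(tmonom (enum_val j)).

Lemma tcoordE f j : tcoord (tproj f) 0 j = f@_(tmonom (enum_val j)).
Proof.
rewrite mxE; have /tproj_eqP := tproj_repr (tproj f); apply.
by apply/truncatedP; exists (enum_val j).
Qed.

Fact truncpoly_vector_axiom : Vector.axiom #|{ffun 'I_n -> 'I_p}| R.
Proof.
exists tcoord.
  move=> a x y; apply/rowP => j; rewrite -(tproj_repr x) -(tproj_repr y).
  by rewrite -linearP tcoordE mcoeffD mcoeffZ -!tcoordE !mxE.
pose g (r : 'rV[K]_#|{ffun 'I_n -> 'I_p}|) :=
  tproj (\sum_j r 0 j *: 'X_[tmonom (enum_val j)]).
have gE r j : tcoord (g r) 0 j = r 0 j.
  rewrite tcoordE raddf_sum (bigD1 j) //= mcoeffZ mcoeffX eqxx mulr1.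
  rewrite big1 ?addr0 // => i ij; rewrite mcoeffZ mcoeffX.
  by rewrite (inj_eq tmonom_inj) (inj_eq enum_val_inj) (negPf ij) mulr0.
exists g => [x|r]; last by apply/rowP => j; rewrite gE.
rewrite -[RHS]tproj_repr; apply/tproj_eqP => k /truncatedP[l ->].
have := gE (tcoord x) (enum_rank l); rewrite tcoordE enum_rankK => ->.
by rewrite mxE enum_rankK.
Qed.

HB.instance Definition _ :=
  Lmodule_hasFinDim.Build K R truncpoly_vector_axiom.

(* The graded pieces R^l and D_l. *)
Definition tpart (l : nat) : {vspace R} :=
  <<[seq tproj 'X_[tmonom k] | k in [pred k | mdeg (tmonom k) == l]]>>%VS.

Lemma tpartP l x :
  reflect (exists2 f, f \is l.-homog & x = tproj f) (x \in tpart l).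
Proof.
rewrite /tpart; set s := [seq _ | _ in _].
apply: (iffP idP) => [xs | [f fl ->]].
  rewrite (coord_span (X := in_tuple s) xs).
  apply: (big_ind (fun y => exists2 f, f \is l.-homog & y = tproj f)).
  - by exists 0; rewrite ?rpred0 ?rmorph0.
  - by move=> _ _ [f fl ->] [g gl ->]; exists (f + g); rewrite ?rpredD ?rmorphD.
  move=> i _; have /mapP[k] : s`_i \in s by exact/mem_nth.
  rewrite mem_enum => /eqP kl ->.
  exists (coord (in_tuple s) i x *: 'X_[tmonom k]); last by rewrite linearZ.
  by apply/rpredZ; rewrite dhomogX; apply/eqP.
rewrite [f]mpolyE linear_sum big_seq memv_suml // => k kf.
rewrite linearZ memvZ //=; case: (boolP (truncated p k)) => [|kp].
  case/truncatedP => m km; rewrite km; apply/memv_span/map_f.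
  by rewrite mem_enum inE; have /dhomogP/(_ _ kf) := fl; rewrite km => <-.
suff -> : tproj 'X_[k] = 0 by rewrite mem0v.
rewrite -(rmorph0 tproj); apply/tproj_eqP => m mp; rewrite mcoeff0 mcoeffX.
by case: eqP => // km; rewrite km mp in kp.
Qed.

(* The action of K[d_1, ..., d_n] on K[y_1, ..., y_n] by partial derivatives. *)
Definition diff_op (d f : P) : P := \sum_(m <- msupp d) d@_m *: f^`M[m].

Lemma diff_opwE b d f : (msize d <= b)%N ->
  diff_op d f = \sum_(m : 'X_{1..n < b}) d@_m *: f^`M[m].
Proof.
move=> le_db; pose Q (m : 'X_{1..n < b}) := (val m) \in msupp d.
rewrite (bigID Q) {}/Q /= addrC big1 ?add0r; last first.
  by move=> m' /memN_msupp_eq0=> ->; rewrite scale0r.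
rewrite /diff_op (big_mksub 'X_{1..n < b}) //=; first exact/msupp_uniq.
by move=> m' /msize_mdeg_lt /leq_trans; apply.
Qed.

Lemma ffact_pchar0 a b : (p <= a + b)%N -> (b < p)%N ->
  ((a + b) ^_ a)%:R = 0 :> K.
Proof.
move=> le_p lt_p; have p_pr := pcharf_prime charKp.
have : (p %| (a + b) ^_ a * b`!)%N.
  rewrite -[X in X`!](addKn a) ffact_fact ?leq_addr //.
  by rewrite dvdn_fact // p_gt0.
have /negPf pb : ~~ (p %| b`!)%N.
  elim: b lt_p {le_p} => [_|b IHb lt_bp]; first by rewrite dvdn1 gtn_eqF ?prime_gt1.
  by rewrite factS (Euclid_dvdM _ _ p_pr) negb_or gtnNdvd // IHb // ltnW.
rewrite (Euclid_dvdM _ _ p_pr) pb orbF.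
by rewrite (dvdn_pcharf charKp) => /eqP.
Qed.

(* The induced action of D on R; [tactE] is its compatibility with the
   quotients. *)
Definition tact (d x : R) : R := tproj (diff_op (repr d) (repr x)).

Lemma tactE d f : tact (tproj d) (tproj f) = tproj (diff_op d f).
Proof.
apply/tproj_eqP => k kp.
have /tproj_eqP dE := tproj_repr (tproj d).
have /tproj_eqP fE := tproj_repr (tproj f).
set d' := repr _ in dE *; set f' := repr _ in fE *.
pose b := maxn (msize d) (msize d').
rewrite !(@diff_opwE b) ?leq_maxl ?leq_maxr // !raddf_sum.
apply: eq_bigr => /= m _; rewrite !mcoeffZ !mcoeff_mderivm.
have [/forallP mkp|] := boolP (truncated p (m + k)).
  rewrite dE ?fE //; apply/forallP => i //.
  by apply: leq_ltn_trans (mkp i); rewrite mnmDE leq_addr.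
case/forallPn => i; rewrite -leqNgt => pi.
suff c0 x : x *+ \prod_(i < n) ((m + k)%MM i) ^_ (m i) = 0 :> K.
  by rewrite !c0 !mulr0.
rewrite -mulr_natr (bigD1 i) //= natrM mnmDE ffact_pchar0 ?mul0r ?mulr0 //.
  by rewrite -mnmDE.
by have /forallP := kp; apply.
Qed.

Lemma tact_part j l d x :
  d \in tpart j -> x \in tpart l -> tact d x \in tpart (l - j).
Proof.
case/tpartP => {}d dj ->; case/tpartP => f fl ->; rewrite tactE.
apply/tpartP; exists (diff_op d f) => //; rewrite /diff_op big_seq.
apply: rpred_sum => m md; apply/rpredZ; have /dhomogP/(_ _ md) <- := dj.
rewrite mderivmE big_seq; apply: rpred_sum => k kf.
have [mk|] := boolP (m <= k)%MM.
  apply/rpredZ; rewrite dhomogX; have /dhomogP/(_ _ kf) <- := fl.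
  by have /= := mdegD (k - m) m; rewrite submK // => ->; rewrite addnK.
case/forallPn => i; rewrite -ltnNge => ki.
by rewrite (bigD1 i) //= ffact_small // mul0n mulr0 scale0r rpred0.
Qed.

End TruncPoly.

Arguments tpart [K] n [p] charKp l.

(* Main.v *)
From HB Require Import structures.
Require Import Defs.
From mathcomp Require Import all_boot all_order all_algebra.
From mathcomp Require Import generic_quotient boolp classical_sets mpoly zify.

(** The inequality is a linear version of the fact that, in the poset of
exponents {0, ..., p-1}^n, a family of m elements of a degree l in the upper half
has at least m elements of the complementary degree n(p-1) - l below it.

Fix a monomial order and let T be the set of leading exponents of the nonzero
elements of V.  A vector of V whose coefficients on T all vanish has no leading
exponent, so it is zero, and therefore dim V <= #|T| ([dim_le_leads]).
Conversely, vectors with pairwise distinct leading exponents are linearly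
independent ([free_leads]).  It thus suffices to produce, inside the span of
D_(2l - n(p-1)) . V, one vector for each t in T, with distinct leading exponents.

If v has leading exponent t and b <= t componentwise, then the monomial operator
of exponent t - b sends v to a vector with leading exponent b ([leads_tact]):
monomial orders are invariant under translation, and the scalar that appears is
a product of falling factorials of numbers smaller than p, hence nonzero in K.
What remains is combinatorial: an injection g from exponents of degree l to
exponents of degree n(p-1) - l with g(t) <= t ([complementary_lowering]).  It
comes from the decomposition of a product of chains into symmetric chains, which
is obtained here from the crystal operators of a tensor product of
representations of sl_2: the lowering operator f decreases one coordinate by one,
has the raising operator e as an inverse wherever it does not vanish, and can be
applied at least 2l - n(p-1) times to any exponent of degree l. *)

Set Implicit Arguments.
Unset Strict Implicit.
Unset Printing Implicit Defensive.
Import Order.TTheory GRing.Theory.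
Local Open Scope ring_scope.

(** * Symmetric chains in a product of chains *)

Section SymmetricChains.
Local Open Scope nat_scope.

(** A sequence [s] with entries in [0..q] is a vertex of a tensor product of
crystals of sl_2, each of them a chain with q + 1 vertices.  [raisable] and
[lowerable] are the string lengths, usually written epsilon and phi, and
[raise] and [lower] are the crystal operators e and f: the tensor product rule
tells which factor they act on.  In terms of parentheses, the entries are read from
the last to the first, an entry [a] standing for [a] closing parentheses followed
by [q - a] opening ones; [lowerable] counts the closing and [raisable] the opening
ones that stay unmatched. *)

Fixpoint raisable q s :=
  if s is a :: s' then (q - a) + (raisable q s' - a) else 0.
Fixpoint lowerable q s :=
  if s is a :: s' then lowerable q s' + (a - raisable q s') else 0.
Fixpoint lower q s :=
  if s is a :: s' then
    if raisable q s' < a then a.-1 :: s' else a :: lower q s'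
  else [::].
Fixpoint raise q s :=
  if s is a :: s' then
    if raisable q s' <= a then a.+1 :: s' else a :: raise q s'
  else [::].

(** The weight of a crystal vertex, phi - epsilon, is additive over the factors
and equals 2a - q on the entry [a]. *)
Lemma lowerableE q s : all (geq q) s ->
  lowerable q s + size s * q = (sumn s).*2 + raisable q s.
Proof.
elim: s => //= a s IHs /andP[aq /IHs]; lia.
Qed.

(** After [lower] has acted on a factor, the tensor product rule makes [raise]
choose the same factor: moving [raisable] up by one and a head entry down by one
turns the strict comparison of [lower] into the large one of [raise]. *)
Lemma lower_spec q s : all (geq q) s -> 0 < lowerable q s ->
  [/\ raisable q (lower q s) = (raisable q s).+1,
      (lowerable q (lower q s)).+1 = lowerable q s,
      (sumn (lower q s)).+1 = sumn s
    & raise q (lower q s) = s].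
Proof.
elim: s => //= a s IHs /andP[aq sq].
case: (ltnP (raisable q s) a) => [lt_a _ | le_a].
  rewrite /=; split; [lia | lia | lia |].
  by rewrite ifT; [rewrite prednK //; lia | lia].
have /eqP-> := le_a; rewrite addn0 => /(IHs sq)[eqr eql eqn eqs] /=.
rewrite eqr eqs; split; [lia | lia | lia |].
by rewrite ifF //; lia.
Qed.

Lemma size_lower q s : size (lower q s) = size s.
Proof. by elim: s => //= a s IHs; case: ifP => //= _; rewrite IHs. Qed.

Lemma nth_lower q s i : nth 0 (lower q s) i <= nth 0 s i.
Proof.
elim: s i => // a s IHs [|i] /=; case: ifP => //= _; exact: leq_pred.
Qed.

Lemma all_lower q s : all (geq q) s -> all (geq q) (lower q s).
Proof.
move/(all_nthP 0) => sq; apply/(all_nthP 0) => i.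
by rewrite size_lower => /sq; apply/leq_trans/nth_lower.
Qed.

Lemma iter_lower_spec q j s (t := iter j (lower q) s) :
  all (geq q) s -> j <= lowerable q s ->
  [/\ all (geq q) t, size t = size s, forall i, nth 0 t i <= nth 0 s i,
      lowerable q t + j = lowerable q s /\ sumn t + j = sumn s
    & iter j (raise q) t = s].
Proof.
move=> sq; rewrite {}/t; elim: j => [|j IHj] ltj; first by rewrite !addn0.
have [tq szt let_ [eqt eqn] eqs] := IHj (ltnW ltj).
have [|_ eql eqn' eqr] := lower_spec tq; first lia.
rewrite /= size_lower; split=> //; [exact: all_lower | | by lia |].
  by move=> i; apply: leq_trans (nth_lower _ _ _) (let_ i).
by rewrite -iterS iterSr /= eqr.
Qed.

Lemma iter_lower_inj q j s s' : all (geq q) s -> all (geq q) s' ->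
  j <= lowerable q s -> j <= lowerable q s' ->
  iter j (lower q) s = iter j (lower q) s' -> s = s'.
Proof.
move=> sq s'q sj s'j eqt.
have [_ _ _ _ <-] := iter_lower_spec sq sj.
by have [_ _ _ _ <-] := iter_lower_spec s'q s'j; rewrite eqt.
Qed.

(** The number of lowering steps from degree l to degree n(p-1) - l is the weight
phi - epsilon of any exponent of degree l, which is at most phi; so the iterate
of [lower] never gets stuck, and it is invertible by [raise]. *)
Lemma complementary_lowering n p l : n * (p - 1) <= 2 * l ->
  exists g : {ffun 'I_n -> 'I_p} -> {ffun 'I_n -> 'I_p},
    (forall k : {ffun 'I_n -> 'I_p}, \sum_i k i = l ->
       (forall i, g k i <= k i) /\
       \sum_i g k i + (2 * l - n * (p - 1)) = l) /\
    {in [pred k : {ffun 'I_n -> 'I_p} | \sum_i k i == l] &, injective g}.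
Proof.
move=> le_l; set j := 2 * l - _; pose q := p - 1.
pose sq (k : {ffun 'I_n -> 'I_p}) := [seq (k i : nat) | i <- enum 'I_n].
have size_sq k : size (sq k) = n by rewrite size_map size_enum_ord.
have nth_sq k (i : 'I_n) : nth 0 (sq k) i = k i.
  by rewrite (nth_map i) ?size_enum_ord ?nth_ord_enum.
have sumn_sq k : sumn (sq k) = \sum_i k i.
  by rewrite sumnE big_map big_enum.
have sq_le k : all (geq q) (sq k).
  by apply/allP => _ /mapP[i _ ->] /=; have := ltn_ord (k i); rewrite /q; lia.
pose t k := iter j (lower q) (sq k).
(* The entries of [t k] are bounded by those of [k] when [k] has degree [l], so the
   default value of [insubd] only affects other degrees. *)
pose g (k : {ffun 'I_n -> 'I_p}) : {ffun 'I_n -> 'I_p} :=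
  [ffun i => insubd (k i) (nth 0 (t k) i)].
have jle (k : {ffun 'I_n -> 'I_p}) : \sum_i k i = l -> j <= lowerable q (sq k).
  have := lowerableE (sq_le k); rewrite size_sq sumn_sq -/q => + kl.
  by rewrite kl; lia.
have gE (k : {ffun 'I_n -> 'I_p}) i :
  \sum_i k i = l -> g k i = nth 0 (t k) i :> nat.
  move=> /jle kl; rewrite ffunE val_insubd ifT //.
  have [_ _ + _ _] := iter_lower_spec (sq_le k) kl => /(_ i).
  by rewrite nth_sq => /leq_ltn_trans; apply.
have tE (k : {ffun 'I_n -> 'I_p}) : \sum_i k i = l -> t k = sq (g k).
  move=> kl; have [_ szt _ _ _] := iter_lower_spec (sq_le k) (jle k kl).
  apply: (@eq_from_nth _ 0) => [|i]; first by rewrite szt !size_sq.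
  by rewrite szt size_sq => ltin; rewrite (nth_sq _ (Ordinal ltin)) gE.
exists g; split=> [k kl | k k' /eqP kl /eqP k'l eqg].
  have [_ _ let_ [_ +] _] := iter_lower_spec (sq_le k) (jle k kl).
  rewrite -/(t k) {1}tE // !sumn_sq kl => eqj; split=> // i.
  by rewrite gE // -nth_sq let_.
have /(iter_lower_inj (sq_le k) (sq_le k') (jle k kl) (jle k' k'l)) : t k = t k'.
  by rewrite !tE ?eqg.
move=> eqs; apply/ffunP => i; apply/val_inj.
by rewrite /= -!nth_sq eqs.
Qed.

End SymmetricChains.

(** * Leading exponents in the truncated polynomial algebra *)

Section LeadingExponents.
Context (K : fieldType) (n p : nat) (charKp : p \in [pchar K]).
Local Notation R := (truncpoly n charKp).
Local Notation E := {ffun 'I_n -> 'I_p}.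
Implicit Types (k m t : E) (x : R) (V : {vspace R}).

Definition tcoef k x : K := (repr x)@_(tmonom k).

Lemma tcoef_tproj k (f : {mpoly K[n]}) : tcoef k (tproj charKp f) = f@_(tmonom k).
Proof.
have /tproj_eqP := tproj_repr (tproj charKp f); apply.
by apply/truncatedP; exists k.
Qed.

Fact tcoef_linear k : scalar (tcoef k).
Proof.
move=> a x y; rewrite -(tproj_repr x) -(tproj_repr y) -linearP.
by rewrite !tcoef_tproj mcoeffD mcoeffZ.
Qed.
HB.instance Definition _ k :=
  GRing.isLinear.Build K R K *%R (tcoef k) (tcoef_linear k).

Lemma tcoef_eq0 x : (forall k, tcoef k x = 0) -> x = 0.
Proof.
move=> x0; rewrite -(tproj_repr x) -(rmorph0 (tproj charKp)).
by apply/tproj_eqP => _ /truncatedP[k ->]; rewrite mcoeff0; apply: x0.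
Qed.

(** Exponents are compared in the graded lexicographic order on monomials, which is
total and invariant under translation. *)
Definition leads k x :=
  (tcoef k x != 0) && [forall m, (tcoef m x != 0) ==> (tmonom m <= tmonom k)%O].

Lemma leads_exists x : x != 0 -> exists k, leads k x.
Proof.
move=> x0; have [k0 k0x] : exists k, tcoef k x != 0.
  apply/existsP; apply: contraNT x0; rewrite negb_exists => /forallP x0.
  by apply/eqP/tcoef_eq0 => k; apply/eqP; have := x0 k; rewrite negbK.
case: (arg_maxP (P := fun k => tcoef k x != 0) (@tmonom n p) k0x) => k kx kmax.
by exists k; rewrite /leads kx; apply/forallP => m; apply/implyP => /kmax.
Qed.

Lemma tcoef_gt_lead k m x : leads k x -> (tmonom k < tmonom m)%O -> tcoef m x = 0.
Proof.
case/andP=> _ /forallP/(_ m); rewrite implybE negbK leNgt.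
by case/orP=> [/eqP // | /negPf->].
Qed.

(** The coefficients on [T] embed [V] into a space of dimension #|T|: a nonzero
vector has a nonzero coefficient at its leading exponent. *)
Lemma dim_le_leads V (T : {set E}) :
  (forall x k, x \in V -> leads k x -> k \in T) -> (\dim V <= #|T|)%N.
Proof.
move=> VT.
pose f (x : R) : 'rV[K]_#|T| := \row_j tcoef (enum_val j) x.
have f_lin : linear f by move=> a x y; apply/rowP => j; rewrite !mxE linearP.
pose fL : {linear R -> 'rV[K]_#|T|} :=
  HB.pack f (GRing.isLinear.Build K R _ _ f f_lin).
pose h := linfun fL.
have hV0 : (V :&: lker h = 0)%VS.
  apply/eqP; rewrite -subv0; apply/subvP => x.
  rewrite memv_cap memv_ker memv0 lfunE /= => /andP[xV /eqP fx0].
  apply: contraT => /leads_exists[k kx].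
  have kT := VT _ _ xV kx; move/rowP/(_ (enum_rank_in kT k)): fx0.
  by rewrite !mxE enum_rankK_in // => kx0; case/andP: kx; rewrite kx0 eqxx.
rewrite -(limg_dim_eq hV0); apply: leq_trans (dimvS (subvf _)) _.
by rewrite dimvf /dim /= mul1n.
Qed.

(** In a nontrivial linear relation, the monomial at the largest leading exponent
carried by a nonzero coefficient cannot be cancelled by the other terms. *)
Lemma free_leads (T : finType) (u : T -> R) (e : T -> E) :
  injective e -> (forall i, leads (e i) (u i)) -> free (codom u).
Proof.
move=> e_inj eu; apply/(@freeP _ _ _ (codom_tuple u)) => c cu0 i; apply/eqP.
apply: contraT => ci; pose e' (i : 'I_#|T|) := e (enum_val i).
have e'u j : leads (e' j) (codom_tuple u)`_j.
  rewrite /= /codom /image_mem (nth_map (enum_val i)) -?cardE //.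
  by rewrite -enum_val_nth; apply: eu.
case: (arg_maxP (P := fun i => c i != 0) (fun i => tmonom (e' i)) ci) => j cj jmax.
have := congr1 (tcoef (e' j)) cu0; rewrite linear_sum linear0 (bigD1 j) //=.
rewrite big1 => [|i' i'j].
  rewrite addr0 linearZ => /eqP; rewrite mulf_eq0 (negPf cj) /=.
  by have /andP[/negPf->] := e'u j.
rewrite linearZ /=; have [->|ci'] := eqVneq (c i') 0; first by rewrite mul0r.
rewrite (tcoef_gt_lead (e'u i')) ?mulr0 // lt_neqAle.
rewrite (inj_eq (@tmonom_inj _ _)) (inj_eq e_inj) (inj_eq enum_val_inj) i'j.
exact: jmax.
Qed.

Lemma ffact_neq0_pchar a b : (a <= b < p)%N -> (b ^_ a)%:R != 0 :> K.
Proof.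
case/andP=> le_ab lt_bp; rewrite ffact_prod natr_prod.
apply/prodf_neq0 => i _; rewrite -(dvdn_pcharf charKp) gtnNdvd //.
  by rewrite subn_gt0 (leq_trans (ltn_ord i)).
exact: leq_ltn_trans (leq_subr _ _) lt_bp.
Qed.

(** A monomial operator translates exponents and multiplies coefficients by
falling factorials.  These vanish in K when the translate leaves the truncated
range, and do not vanish at the leading exponent, whose entries are below p. *)
Lemma leads_tact (a : 'X_{1..n}) b k x :
  leads k x -> tmonom k = (a + tmonom b)%MM ->
  leads b (tact (tproj charKp 'X_[a]) x).
Proof.
move=> kx kE.
have coefE m : tcoef m (tact (tproj charKp 'X_[a]) x) =
    (repr x)@_(a + tmonom m) *+ \prod_i ((a + tmonom m)%MM i) ^_ (a i).
  rewrite -{1}(tproj_repr x) tactE tcoef_tproj /diff_op msuppX big_seq1.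
  by rewrite mcoeffX eqxx scale1r mcoeff_mderivm.
apply/andP; split.
  rewrite coefE -kE -mulr_natr mulf_neq0 //; first by case/andP: kx.
  rewrite natr_prod; apply/prodf_neq0 => i _; rewrite ffact_neq0_pchar //.
  by rewrite {1}kE mnmDE leq_addr mnmE ltn_ord.
apply/forallP => m; apply/implyP; rewrite coefE => mx.
(* Outside the truncated range [repr x] may have arbitrary coefficients, so that
   the vanishing has to come from the falling factorial. *)
have /truncatedP[k' k'E] : truncated p (a + tmonom m).
  apply: contraR mx => /forallPn[i]; rewrite -leqNgt => pi.
  rewrite -mulr_natr (bigD1 i) //= natrM mnmDE (ffact_pchar0 charKp).
  - by rewrite mul0r mulr0.
  - by rewrite -mnmDE.
  - by rewrite mnmE.
have : tcoef k' x != 0.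
  by apply: contraNneq mx; rewrite k'E /tcoef => ->; rewrite mul0rn.
case/andP: kx => _ /forallP/(_ k')/implyP/[apply].
by rewrite kE -k'E lemc_add2r.
Qed.

Lemma mdeg_tmonom k : mdeg (tmonom k) = (\sum_i k i)%N.
Proof. by rewrite mdegE; apply: eq_bigr => i _; rewrite mnmE. Qed.

Lemma leads_degree l x k : x \in tpart n charKp l -> leads k x ->
  (\sum_i k i)%N = l.
Proof.
case/tpartP => f fl -> /andP[+ _]; rewrite tcoef_tproj => kf.
have /dhomogP/(_ (tmonom k)) := fl; rewrite mcoeff_msupp => /(_ kf) <-.
by rewrite [RHS]mdeg_tmonom.
Qed.

End LeadingExponents.

(** * The dimension inequality *)

Theorem proposition4p7 (K : fieldType) (p : nat) (charKp : p \in [pchar K])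
    (n : nat) (n_ge1 : (1 <= n)%N) (l : nat) (V : {vspace truncpoly n charKp}) :
  (V <= tpart n charKp l)%VS ->
  (n * (p - 1) <= 2 * l)%N -> (l <= n * (p - 1))%N ->
  (\dim V <= \dim (linear_hull
     [set tact d v | d in [set` tpart n charKp (2 * l - n * (p - 1))]
                   & v in [set` V]]%classic))%N.
Proof.
move=> Vl le_l _; set j := (2 * l - _)%N; set W := linear_hull _.
have [g [gP g_inj]] := complementary_lowering (p := p) le_l.
pose T := [set k : {ffun 'I_n -> 'I_p} | `[< exists2 v, v \in V & leads k v >]].
have deg_T k : k \in T -> (\sum_i k i)%N = l.
  by rewrite inE => /asboolP[v vV]; apply: leads_degree; apply: (subvP Vl).
apply: leq_trans (dim_le_leads (T := T) _) _ => [x k xV kx|].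
  by rewrite inE; apply/asboolP; exists x.
have /choice[v vP] (k : {k | k \in T}) :
    exists v : truncpoly n charKp, v \in V /\ leads (val k) v.
  by case: k => k /=; rewrite inE => /asboolP[v]; exists v.
pose a (k : {k | k \in T}) := (tmonom (val k) - tmonom (g (val k)))%MM.
pose u k := tact (tproj charKp 'X_[a k]) (v k).
have gle (k : {k | k \in T}) : (tmonom (g (val k)) <= tmonom (val k))%MM.
  have [gk _] := gP _ (deg_T _ (valP k)).
  by apply/mnm_lepP => i; rewrite !mnmE.
have free_u : free (codom u).
  apply: (free_leads (e := fun k => g (val k))) => [k k' eqg | k].
    by apply/val_inj/g_inj => //; rewrite inE; apply/eqP/deg_T/valP.
  by apply: leads_tact (vP k).2 _; rewrite submK.
have <- : size (codom u) = #|T|.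
  by rewrite size_codom card_sig.
rewrite -(eqP free_u); apply/dimvS/span_subvP => _ /codomP[k ->].
apply: mem_linear_hull; exists (tproj charKp 'X_[a k]); last first.
  by exists (v k) => //; case: (vP k).
apply/tpartP; exists 'X_[a k] => //; rewrite dhomogX /=.
have [_ dk] := gP _ (deg_T _ (valP k)).
have := congr1 mdeg (submK (gle k)); rewrite mdegD !mdeg_tmonom.
rewrite (deg_T _ (valP k)) addnC => eqd.
by rewrite -(eqn_add2l (\sum_i g (val k) i)%N) eqd dk.
Qed.
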